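(* Let $\Sigma=(X,\mathcal{D},\phi)$ be a forward complete system. If there exists a non-coercive Lyapunov function $V$ for $\Sigma$, then $0$ is uniformly globally weakly attractive for $\Sigma$.
   Context: Notation: $\mathbb{R}_+=[0,\infty)$. $\mathcal{K}$ is the set of continuous strictly increasing $\gamma:\mathbb{R}_+\to\mathbb{R}_+$ with $\gamma(0)=0$; $\mathcal{K}_\infty$ is the set of unbounded $\gamma\in\mathcal{K}$. System: A (forward complete dynamical) system $\Sigma=(X,\mathcal{D},\phi)$ consists of a normed linear space $(X,\|\cdot\|_X)$, a set $D$ of disturbance values (a nonempty subset of a normed linear space), a set $\mathcal{D}$ of functions $d:\mathbb{R}_+\to D$, and a map $\phi:\mathbb{R}_+\times X\times\mathcal{D}\to X$ (defined everywhere). $\mathcal{D}$ is shift-invariant ($d\in\mathcal{D}$, $\tau\ge0$ imply $d(\cdot+\tau)\in\mathcal{D}$) and closed under concatenation (for $d_1,d_2\in\mathcal{D}$, $t>0$, the function equal to $d_1(\tau)$ for $\tau\in[0,t]$ and $d_2(\tau-t)$ for $\tau>t$ is in $\mathcal{D}$). Moreover: $\phi(0,x,d)=x$ for all $x,d$; causality: if $d(s)=\tilde d(s)$ for all $s\in[0,t]$ then $\phi(t,x,d)=\phi(t,x,\tilde d)$; for each $(x,d)$ the map $t\mapsto\phi(t,x,d)$ is continuous; cocycle property: $\phi(h,\phi(t,x,d),d(t+\cdot))=\phi(t+h,x,d)$ for all $t,h\ge0$, $x\in X$, $d\in\mathcal{D}$. Non-coercive Lyapunov function: a continuous $V:X\to\mathbb{R}_+$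 with $V(0)=0$ for which there exist $\psi_2\in\mathcal{K}_\infty$ and $\alpha\in\mathcal{K}$ such that $0<V(x)\le\psi_2(\|x\|_X)$ for all $x\in X\setminus\{0\}$, and $\dot V_d(x):=\liminf_{t\to+0}\frac1t\big(V(\phi(t,x,d))-V(x)\big)\le-\alpha(\|x\|_X)$ for all $x\in X$, $d\in\mathcal{D}$. Uniformly globally weakly attractive: for every $\varepsilon>0$ and every $r>0$ there is $\tau=\tau(\varepsilon,r)$ such that for all $x\in X$ with $\|x\|_X\le r$ and all $d\in\mathcal{D}$ there exists $t=t(x,d,\varepsilon)\in[0,\tau]$ with $\|\phi(t,x,d)\|_X\le\varepsilon$. *)

(* Defs.v *)
From HB Require Import structures.
From mathcomp Require Import all_boot all_order all_algebra.
From mathcomp Require Import all_classical all_reals all_analysis.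

Set Implicit Arguments.
Unset Strict Implicit.
Unset Printing Implicit Defensive.

Import Order.TTheory GRing.Theory Num.Theory.
Import numFieldNormedType.Exports.

Local Open Scope classical_set_scope.
Local Open Scope ring_scope.

(* A map whose domain is R_+ = [0, +oo[ is represented by a function on R; its
   values at negative arguments are junk, and nothing is assumed of them. *)

Record class_K (R : realType) (gamma : R -> R) : Prop := ClassK {
  class_K_ge0 : forall s, 0 <= s -> 0 <= gamma s;
  class_K_continuous : {within `[0, +oo[, continuous gamma};
  class_K_increasing : forall s t, 0 <= s -> s < t -> gamma s < gamma t;
  class_K_0 : gamma 0 = 0 }.

Definition class_Kinfty (R : realType) (gamma : R -> R) : Prop :=
  class_K gamma /\ forall M : R, exists2 s, 0 <= s & M < gamma s.

Definition shift_disturbance (R : realType) (U : Type) (tau : R) (d : R -> U)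
  : R -> U := fun s => d (s + tau).

Definition concat_disturbance (R : realType) (U : Type) (t : R)
    (d1 d2 : R -> U) : R -> U :=
  fun s => if s <= t then d1 s else d2 (s - t).

(* The flow is a total function, but it is only constrained (and only used) at
   times t >= 0 and disturbances in [disturbance]. By [flow_causal] it does not
   depend on the values of a disturbance at negative times. *)
Record system (R : realType) (X U : normedModType R) := System {
  disturbance_value : set U;
  disturbance : set (R -> U);
  flow : R -> X -> (R -> U) -> X;
  disturbance_value_nonempty : disturbance_value !=set0;
  disturbance_range : forall d, disturbance d ->
    forall s, 0 <= s -> disturbance_value (d s);
  disturbance_shift : forall d tau, disturbance d -> 0 <= tau ->
    disturbance (shift_disturbance tau d);
  disturbance_concat : forall d1 d2 t, disturbance d1 -> disturbance d2 ->
    0 < t -> disturbance (concat_disturbance t d1 d2);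
  flow_0 : forall x d, disturbance d -> flow 0 x d = x;
  flow_causal : forall t x d d', 0 <= t -> disturbance d -> disturbance d' ->
    (forall s, 0 <= s <= t -> d s = d' s) -> flow t x d = flow t x d';
  flow_continuous : forall x d, disturbance d ->
    {within `[0, +oo[, continuous (fun t => flow t x d)};
  flow_cocycle : forall t h x d, 0 <= t -> 0 <= h -> disturbance d ->
    flow h (flow t x d) (shift_disturbance t d) = flow (t + h) x d }.

(* The liminf is taken in the extended reals: it may be infinite. *)
Definition lower_dini (R : realType) (X U : normedModType R)
    (Sigma : system X U) (V : X -> R) (d : R -> U) (x : X) : \bar R :=
  limf_einf (fun t : R => (t^-1 * (V (flow Sigma t x d) - V x))%:E) 0^'+.

Record noncoercive_lyapunov (R : realType) (X U : normedModType R)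
    (Sigma : system X U) (V : X -> R) : Prop := NoncoerciveLyapunov {
  lyapunov_ge0 : forall x, 0 <= V x;
  lyapunov_continuous : continuous V;
  lyapunov_0 : V 0 = 0;
  lyapunov_bounds : exists psi2 alpha : R -> R,
    [/\ class_Kinfty psi2, class_K alpha,
        forall x, x != 0 -> 0 < V x <= psi2 `|x| &
        forall x d, disturbance Sigma d ->
          (lower_dini Sigma V d x <= (- alpha `|x|)%:E)%E] }.

Definition uniformly_globally_weakly_attractive (R : realType)
    (X U : normedModType R) (Sigma : system X U) : Prop :=
  forall eps r : R, 0 < eps -> 0 < r ->
    exists tau : R, forall x d, `|x| <= r -> disturbance Sigma d ->
      exists2 t, 0 <= t <= tau & `|flow Sigma t x d| <= eps.

(* Main.v *)
Require Import Defs.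
From mathcomp Require Import all_boot all_order all_algebra.
From mathcomp Require Import all_classical all_reals all_analysis.
From mathcomp Require Import lra.

(** Fix a trajectory that starts in the ball of radius [r] and suppose that it
    stays at norm larger than [eps] during [[0, T]]. Along it [V] decreases with
    lower right Dini derivative at most [- alpha eps] ([alpha] is increasing), so
    that [V] ends at most at [psi2 r - (alpha eps / 2) * T]. As [V >= 0], this bounds
    [T] in terms of [eps] and [r] only: every longer time serves as [tau].

    Integrating the differential inequality calls for some care because the
    derivative is a limit inferior: it only says that arbitrarily soon after each
    time [s] there is a time [t] with [V] smaller by more than [c * (t - s)], for
    a chosen [c < alpha eps] ([lower_dini_decrease]). This is enough: the
    continuous function [t |-> V (flow t) + c * t] has a minimum on [[0, T]], and
    the minimum cannot be at a time before [T], hence it is at [T]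
    ([le_right_end]). Giving up half of the rate, [c = alpha eps / 2], costs
    nothing since only some finite [tau] is wanted. *)

Set Implicit Arguments.
Unset Strict Implicit.
Unset Printing Implicit Defensive.

Import Order.TTheory GRing.Theory Num.Theory.
Import numFieldNormedType.Exports.

Local Open Scope classical_set_scope.
Local Open Scope ring_scope.

Lemma limf_einf_lt_frequently (T : choiceType) (X : filteredType T)
    (R : realType) (f : X -> \bar R) (F : set (set X)) (l : \bar R)
    (A : set X) :
  (limf_einf f F < l)%E -> F A -> exists2 x, A x & (f x < l)%E.
Proof.
rewrite limf_einfE => fl FA.
have infA : (ereal_inf (f @` A) < l)%E.
  by apply: le_lt_trans fl; apply: ereal_sup_ubound; exists A.
apply: contrapT => noA; move: infA; rewrite ltNge => /negP; apply.
apply: le_ereal_inf_tmp => _ [x Ax <-]; rewrite leNgt; apply/negP => fxl.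
by apply: noA; exists x.
Qed.

(** A minimum over [[a, b]] exists by compactness, and the hypothesis excludes
    every point but [b]. The hypothesis gives a single later time [t] and not a
    right neighbourhood of [s], because a bound on a limit inferior yields no
    more than that. *)
Lemma le_right_end (R : realType) (f : R -> R) (a b : R) :
  {within `[a, b], continuous f} ->
  (forall s, a <= s < b -> exists2 t, s <= t <= b & f t < f s) ->
  forall s, a <= s <= b -> f b <= f s.
Proof.
move=> fcont fdecr s /andP[as_ sb].
have [m + fmin] := EVT_min (le_trans as_ sb) fcont.
rewrite in_itv/= => /andP[am]; rewrite le_eqVlt => /predU1P[mb|mb].
  by rewrite -mb; apply: fmin; rewrite in_itv/= as_.
have [|t /andP[mt tb]] := fdecr m; first by rewrite am.
by rewrite ltNge fmin// in_itv/= tb (le_trans am).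
Qed.

Lemma class_K_gt0 (R : realType) (gamma : R -> R) (s : R) :
  class_K gamma -> 0 < s -> 0 < gamma s.
Proof.
by move=> gammaK s0; rewrite -[ltLHS](class_K_0 gammaK) class_K_increasing.
Qed.

Lemma class_K_le (R : realType) (gamma : R -> R) (s t : R) :
  class_K gamma -> 0 <= s -> s <= t -> gamma s <= gamma t.
Proof.
move=> gammaK s0; rewrite le_eqVlt => /predU1P[->//|st].
by apply/ltW/class_K_increasing.
Qed.

Section trajectories.
Context {R : realType} {X U : normedModType R} {Sigma : system X U}.
Implicit Types (V : X -> R) (d : R -> U) (x : X).

(** The limit inferior being below [- c] yields difference quotients below [- c]
    at arbitrarily small positive times, not at all of them. *)
Lemma lower_dini_decrease V d x (c T : R) :
  (lower_dini Sigma V d x < (- c)%:E)%E -> 0 < T ->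
  exists2 h, 0 < h <= T & V (flow Sigma h x d) < V x - c * h.
Proof.
move=> dini T0.
have near0 : \forall h \near 0^'+, 0 < h <= T.
  near=> h; apply/andP; split; near: h; first exact: nbhs_right_gt.
  exact: nbhs_right_le.
have [h /andP[h0 hT]] := limf_einf_lt_frequently dini near0.
rewrite lte_fin -[_^-1 * _]mulrC ltr_pdivrMr// => Vh.
by exists h; [rewrite h0 | rewrite ltrBlDl -mulNr in Vh *; lra].
Unshelve. all: by end_near. Qed.

(** The cocycle property turns the decrease at the state [flow s x d], driven by
    the shifted disturbance, into a decrease along the trajectory after [s]. *)
Lemma lyapunov_decrease V d x (c T : R) :
  continuous V -> disturbance Sigma d ->
  (forall s, 0 <= s < T ->
    (lower_dini Sigma V (shift_disturbance s d) (flow Sigma s x d)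
      < (- c)%:E)%E) ->
  0 <= T -> V (flow Sigma T x d) + c * T <= V x.
Proof.
move=> Vcont dD dini T0; pose f t := V (flow Sigma t x d) + c * t.
have -> : V x = f 0 by rewrite /f flow_0// mulr0 addr0.
apply: (@le_right_end _ f 0 T); last by rewrite lexx T0.
  have Vflow : {within `[0, +oo[, continuous (V \o (fun t => flow Sigma t x d))}.
    apply: within_continuous_comp; last exact: flow_continuous.
    by move=> y _; exact: Vcont.
  have fcont : {within `[0, +oo[, continuous f}.
    move=> t; apply: cvgD; first exact: Vflow.
    by apply: continuous_subspaceT => {}t; exact: mulrl_continuous.
  apply: continuous_subspaceW fcont.
  by move=> t /=; rewrite !in_itv/= => /andP[->].
move=> s /andP[s0 sT].
have [||h /andP[h0 hT]] := @lower_dini_decrease V (shift_disturbance s d)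
  (flow Sigma s x d) c (T - s).
- by apply: dini; rewrite s0.
- by rewrite subr_gt0.
rewrite flow_cocycle ?(ltW h0)// => Vh.
by exists (s + h); [apply/andP; split; lra | rewrite /f mulrDr; lra].
Qed.

End trajectories.

Theorem proposition3p7 (R : realType) (X U : normedModType R)
    (Sigma : system X U) :
  (exists V : X -> R, noncoercive_lyapunov Sigma V) ->
  uniformly_globally_weakly_attractive Sigma.
Proof.
move=> [V [V_ge0 Vcont V0 [psi2 [alpha [[psi2K _] alphaK Vpsi2 Vdini]]]]].
move=> eps r eps0 r0.
have a0 := class_K_gt0 alphaK eps0.
have p0 := class_K_gt0 psi2K r0.
pose c := alpha eps / 2.
have c0 : 0 < c by rewrite /c; lra.
(* With this horizon the bound [psi2 r - c * tau] on [V] is [-1]. *)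
pose tau := (psi2 r + 1) / c.
have tau0 : 0 <= tau by rewrite /tau divr_ge0 ?ltW//; lra.
exists tau => x d xr dD; apply: contrapT => stay.
have outside s : 0 <= s <= tau -> eps < `|flow Sigma s x d|.
  by move=> s_tau; rewrite ltNge; apply/negP => small; apply: stay; exists s.
have Vx : V x <= psi2 r.
  have [->|x0] := eqVneq x 0; first by rewrite V0 ltW.
  have /andP[_ /le_trans] := Vpsi2 _ x0; apply; exact: class_K_le.
have : V (flow Sigma tau x d) + c * tau <= V x.
  apply: lyapunov_decrease => // s /andP[s0 s_tau].
  apply: le_lt_trans (Vdini _ _ _) _; first exact: disturbance_shift.
  have : alpha eps <= alpha `|flow Sigma s x d|.
    by apply: class_K_le; rewrite // ltW// outside// s0 ltW.
  by rewrite lte_fin /c; lra.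
rewrite [c * tau]mulrC divfK ?gt_eqF//.
have := V_ge0 (flow Sigma tau x d); lra.
Qed.
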